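(* Fix integers $n,m\geq1$ and $p\in(0,1)$. Let $\pi\sim\nu^{(p)}_{n,m}$ and set $I_n=\operatorname{inv}(\pi)$ and $\delta=2p-1$. Then $$\mathbb{E}[I_n]=\binom n2\left(\frac12-\frac{\delta}{2m}\right),$$ and $$\operatorname{Var}(I_n)=\frac{n(n-1)(2n+5)}{72}+\frac{n(n-1)(n-2)}{18m^2}-\frac{\delta^2n(n-1)(2n-1)}{24m^2}.$$
   Context: Asymmetric shelf shuffle: let $m\ge 1$ be an integer, $p\in(0,1)$, $q=1-p$. A deck of $n$ cards labelled $1,\ldots,n$ from top to bottom is dealt sequentially from the bottom (card $n$ first, card $1$ last). Each card is assigned to one of $m$ labelled shelves independently and uniformly at random, and is placed at the top of the existing pile on that shelf with probability $p$ and at the bottom with probability $q$, independently of everything else. The shuffled deck is formed by joining the piles in shelf order (shelf $1$ on top, then shelf $2$, and so on). The resulting random permutation is $\pi=(\pi_1,\ldots,\pi_n)\in S_n$, where $\pi_i$ is the label of the card in position $i$ from the top, and $\nu^{(p)}_{n,m}$ denotes its law on $S_n$. $\operatorname{inv}(\pi)=|\{(i,j):1\le i<j\le n,\ \pi_i>\pi_j\}|$ is the number of inversions. *)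

(* Defs.v *)
From HB Require Import structures.
From mathcomp Require Export all_boot all_order all_algebra all_fingroup.
From mathcomp Require Export all_classical all_reals all_analysis.

Set Implicit Arguments.
Unset Strict Implicit.
Unset Printing Implicit Defensive.

Import Order.TTheory GRing.Theory Num.Theory.
Import numFieldNormedType.Exports.

Local Open Scope ring_scope.

(* Cards, shelves and deck positions are numbered from 0: the card labelled
   k + 1 is k : 'I_n, and a shuffled deck is read from top to bottom. *)

Section ShelfShuffle.
Variables n m : nat.

(* The choices made for the cards: (c i).1 is the shelf of card i, and (c i).2
   is true when card i goes to the top of the pile on that shelf. *)
Definition choices := {ffun 'I_n -> 'I_m * bool}.

(* Each pile is listed from top to bottom. *)
Definition piles := {ffun 'I_m -> seq 'I_n}.

Definition place (c : choices) (h : piles) (i : 'I_n) : piles :=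
  [ffun s => if s == (c i).1
             then if (c i).2 then i :: h s else rcons (h s) i
             else h s].

(* The bottom card is dealt first, whence the reversal. *)
Definition deal (c : choices) : piles :=
  foldl (place c) [ffun=> [::]] (rev (enum 'I_n)).

Definition shuffled_deck (c : choices) : seq 'I_n :=
  flatten [seq deal c s | s <- enum 'I_m].

Variable R : realType.

Definition choices_prob (p : R) (c : choices) : R :=
  \prod_(i < n) (m%:R^-1 * (if (c i).2 then p else 1 - p)).

(* The law nu_{n,m}^{(p)} on S_n, as a probability mass function.  The list
   codom s is [:: s 0; ...; s (n - 1)], so s i is the card in position i. *)
Definition shelf_law (p : R) (s : 'S_n) : R :=
  \sum_(c : choices | shuffled_deck c == codom s) choices_prob p c.

Definition inversions (s : 'S_n) : nat :=
  #|[set ij : 'I_n * 'I_n | (ij.1 < ij.2)%N && (s ij.2 < s ij.1)%N]|.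

End ShelfShuffle.

(* pi is a random element of the finite set F, measurable for the discrete
   sigma-algebra, whose law has probability mass function f. *)
Definition has_law (d : measure_display) (T : measurableType d) (R : realType)
    (P : probability T R) (F : finType) (pi : T -> F) (f : F -> R) : Prop :=
  forall x : F, measurable (pi @^-1` [set x])%classic /\
                P (pi @^-1` [set x])%classic = (f x)%:E.

(* Main.v *)
Require Import Defs.
From mathcomp Require Import ring.

(** The number of inversions is a sum of a fixed 0/1 kernel over pairs of cards.
    Card i is dealt after all larger cards, so its own choice decides, on its
    shelf, whether it ends above or below all of them.  Hence the cards i < j are
    inverted exactly when j sits on a shelf before that of i, or both share a
    shelf and i went to the bottom ([inversions_shuffled_deck]).  With
    independent identically distributed choices x_1, ..., x_n this reads
    I_n = sum over i < j of X(x_i, x_j), and the mean of I_n is C(n, 2) times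
    the mean inv_prob of X ([iid_mean_pair_sum]).

    For the variance, let K = X - inv_prob, with projections f(a) = E K(a, x)
    and g(b) = E K(x, b).  Only pairs of pairs sharing a card contribute
    covariances: E f^2 if the common card is the smaller one of both pairs,
    E g^2 if it is the larger one of both, and E f g if it is the middle one.
    Here f(a) = (shelf + [a went to the bottom]) / m + const and
    g(b) = - shelf / m + const, so f + g depends only on the top/bottom bit, which
    is independent of the shelf and therefore of g: E (f + g) g = 0
    ([centred_inverts_orth]).  The middle and largest-card contributions thus
    cancel, each type of overlap occurring equally often, which leaves
      Var I_n = C(n, 2) E K^2 + n (n - 1) (n - 2) / 3 * E f^2
    ([iid_mean_pair_sum_sqr]).  The rest is the evaluation of E K^2 and E f^2
    ([mean_centred_inverts_sqr], [mean_centred_inverts_row_sqr]), which involves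
    only sums of the first two powers over the shelves. *)

Import Order.TTheory GRing.Theory Num.Theory.

Set Implicit Arguments.
Unset Strict Implicit.
Unset Printing Implicit Defensive.

Local Open Scope ring_scope.

(** * Pair statistics of independent draws *)

Section IidMean.
Variables (R : realFieldType) (A : finType) (w : A -> R).
Hypothesis w1 : \sum_a w a = 1.

Definition mean (f : A -> R) : R := \sum_a w a * f a.

(** The mean of [f] over lists of [n] independent draws from [w].  Lists, rather
    than functions on ['I_n], let all moments be computed by induction on [n]. *)
Fixpoint iid_mean (n : nat) (f : seq A -> R) : R :=
  if n is k.+1 then mean (fun a => iid_mean k (fun l => f (a :: l))) else f [::].

Fixpoint pair_sum (K : A -> A -> R) (l : seq A) : R :=
  if l is a :: l' then \sum_(b <- l') K a b + pair_sum K l' else 0.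

Lemma eq_mean f g : f =1 g -> mean f = mean g.
Proof. by move=> fg; apply: eq_bigr => a _; rewrite fg. Qed.

Lemma meanD f g : mean (fun a => f a + g a) = mean f + mean g.
Proof. by rewrite -big_split; apply: eq_bigr => a _; rewrite mulrDr. Qed.

Lemma meanZ k f : mean (fun a => k * f a) = k * mean f.
Proof. by rewrite big_distrr; apply: eq_bigr => a _; rewrite mulrCA. Qed.

Lemma mean_cst k : mean (fun=> k) = k.
Proof. by rewrite /mean -big_distrl /= w1 mul1r. Qed.

Lemma mean_exchange (F : A -> A -> R) :
  mean (fun a => mean (F a)) = mean (fun b => mean (F^~ b)).
Proof.
rewrite /mean; under eq_bigr do rewrite big_distrr.
rewrite exchange_big /=; apply: eq_bigr => b _; rewrite big_distrr /=.
by apply: eq_bigr => a _; rewrite mulrCA.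
Qed.

Lemma eq_iid_mean n f g :
  (forall l, size l = n -> f l = g l) -> iid_mean n f = iid_mean n g.
Proof.
elim: n f g => [|n IH] f g fg /=; first exact: fg.
by apply: eq_mean => a; apply: IH => l ln; apply: fg; rewrite /= ln.
Qed.

Lemma iid_meanD n f g :
  iid_mean n (fun l => f l + g l) = iid_mean n f + iid_mean n g.
Proof.
elim: n f g => [//|n IH] f g /=; rewrite -meanD.
by apply: eq_mean => a; rewrite IH.
Qed.

Lemma iid_meanZ n k f : iid_mean n (fun l => k * f l) = k * iid_mean n f.
Proof.
elim: n f => [//|n IH] f /=; rewrite -meanZ.
by apply: eq_mean => a; rewrite IH.
Qed.

Lemma iid_mean_cst n k : iid_mean n (fun=> k) = k.
Proof. by elim: n => [//|n IH] /=; rewrite -[RHS]mean_cst; apply: eq_mean. Qed.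

Lemma iid_mean_exchange n (F : A -> seq A -> R) :
  mean (fun a => iid_mean n (F a)) = iid_mean n (fun l => mean (F^~ l)).
Proof.
elim: n F => [//|n IH] F /=; rewrite mean_exchange.
by apply: eq_mean => b; rewrite IH.
Qed.

Lemma iid_mean_sum n f :
  iid_mean n (fun l => \sum_(b <- l) f b) = n%:R * mean f.
Proof.
elim: n => [|n IH] /=; first by rewrite big_nil mul0r.
under eq_mean => a.
  under eq_iid_mean do rewrite big_cons.
  rewrite iid_meanD iid_mean_cst IH; over.
by rewrite meanD mean_cst -natr1; ring.
Qed.

Lemma iid_mean_sum_mul n f g :
  iid_mean n (fun l => (\sum_(b <- l) f b) * \sum_(b <- l) g b) =
  n%:R * mean (fun a => f a * g a) + n%:R * (n%:R - 1) * (mean f * mean g).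
Proof.
elim: n => [|n IH] /=; first by rewrite !big_nil; ring.
have step a l : (\sum_(b <- a :: l) f b) * (\sum_(b <- a :: l) g b) =
    f a * g a + (f a * \sum_(b <- l) g b + (g a * (\sum_(b <- l) f b) +
     (\sum_(b <- l) f b) * \sum_(b <- l) g b)).
  by rewrite !big_cons; ring.
under eq_mean => a.
  under eq_iid_mean do rewrite step.
  rewrite !iid_meanD !iid_meanZ iid_mean_cst !iid_mean_sum IH.
  rewrite [f a * (_ * _)]mulrC [g a * (_ * _)]mulrC; over.
by rewrite !meanD !meanZ !mean_cst -natr1; ring.
Qed.

Lemma iid_mean_pair_sum n K :
  iid_mean n (pair_sum K) =
  n%:R * (n%:R - 1) / 2 * mean (fun a => mean (K a)).
Proof.
elim: n => [|n IH] /=; first by rewrite !mul0r.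
under eq_mean do rewrite iid_meanD iid_mean_sum IH.
by rewrite meanD mean_cst meanZ -natr1; field.
Qed.

(** The second moment of [pair_sum K] for a centred kernel, with [f] and [g] its
    projections on the first and on the second draw. *)
Section SecondMoment.
Variable K : A -> A -> R.
Let f a := mean (K a).
Let g b := mean (K^~ b).
Hypothesis K_centred : mean f = 0.
Hypothesis fg_orth : mean (fun a => (f a + g a) * g a) = 0.

Let g_centred : mean g = 0.
Proof. by rewrite -[LHS]mean_exchange. Qed.

(** The draw [b] in the last factor is correlated with the pairs in which it
    comes first, through [f b * g b], and with those in which it comes second,
    through [g b * g b]; over all positions the two occur equally often and
    cancel by [fg_orth]. *)
Lemma pair_sum_col_orth n :
  iid_mean n (fun l => pair_sum K l * \sum_(b <- l) g b) = 0.
Proof.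
elim: n => [|n IH] /=; first by rewrite mul0r.
have step a l :
    (\sum_(b <- l) K a b + pair_sum K l) * (\sum_(b <- a :: l) g b) =
    g a * (\sum_(b <- l) K a b) + (g a * pair_sum K l +
    ((\sum_(b <- l) K a b) * (\sum_(b <- l) g b) +
     pair_sum K l * \sum_(b <- l) g b)).
  by rewrite !big_cons; ring.
have cond a : iid_mean n (fun l =>
      (\sum_(b <- l) K a b + pair_sum K l) * (\sum_(b <- a :: l) g b)) =
    n%:R * (f a * g a) + n%:R * mean (fun b => K a b * g b).
  under eq_iid_mean do rewrite step.
  rewrite !iid_meanD !iid_meanZ iid_mean_sum iid_mean_pair_sum K_centred IH.
  by rewrite iid_mean_sum_mul g_centred -/(f a); ring.
rewrite (eq_mean cond) meanD !meanZ mean_exchange -mulrDr.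
have -> : mean (fun b => mean (fun a => K a b * g b)) =
    mean (fun b => g b * g b).
  by apply: eq_mean => b; rewrite -meanZ; apply: eq_mean => a; rewrite mulrC.
rewrite -meanD -[RHS](mulr0 n%:R) -[in RHS]fg_orth; congr (_ * _).
by apply: eq_mean => a; rewrite mulrDl.
Qed.

(** A new first draw [a] adds the row sum of [K a].  Averaged over [a] that row
    sum becomes the sum of [g], so that its covariance with the earlier pairs
    vanishes by [pair_sum_col_orth]; the increment is the mean square of the row
    sum alone. *)
Lemma iid_mean_pair_sum_sqr n :
  iid_mean n (fun l => pair_sum K l ^+ 2) =
  n%:R * (n%:R - 1) / 2 * mean (fun a => mean (fun b => K a b ^+ 2)) +
  n%:R * (n%:R - 1) * (n%:R - 2) / 3 * mean (fun a => f a ^+ 2).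
Proof.
elim: n => [|n IH] /=; first by field.
have step a l : (\sum_(b <- l) K a b + pair_sum K l) ^+ 2 =
    (\sum_(b <- l) K a b) * (\sum_(b <- l) K a b) +
    (2 * (pair_sum K l * (\sum_(b <- l) K a b)) + pair_sum K l ^+ 2).
  by ring.
under eq_mean => a.
  under eq_iid_mean do rewrite step.
  rewrite !iid_meanD iid_meanZ iid_mean_sum_mul IH; over.
rewrite !meanD !meanZ mean_cst iid_mean_exchange.
have -> : iid_mean n
    (fun l => mean (fun a => pair_sum K l * \sum_(b <- l) K a b)) = 0.
  rewrite -[RHS](pair_sum_col_orth n); apply: eq_iid_mean => l _.
  rewrite meanZ; congr (_ * _); elim: l => [|b l IHl].
    by rewrite big_nil -[RHS]mean_cst; apply: eq_mean => a; rewrite big_nil.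
  by rewrite big_cons -IHl -meanD; apply: eq_mean => a; rewrite big_cons.
have -> : mean (fun a => mean (fun b => K a b * K a b)) =
    mean (fun a => mean (fun b => K a b ^+ 2)) by [].
have -> : mean (fun a => mean (K a) * mean (K a)) =
    mean (fun a => f a ^+ 2) by [].
by rewrite mean_cst -[n.+1%:R]natr1; field.
Qed.
End SecondMoment.

Lemma pair_sum_shift K k l :
  pair_sum (fun a b => K a b - k) l =
  pair_sum K l - (size l)%:R * ((size l)%:R - 1) / 2 * k.
Proof.
elim: l => [|a l IH] /=; first by field.
rewrite IH sumrB big_const_seq count_predT iter_addr_0 -[k *+ _]mulr_natl.
by rewrite -natr1; field.
Qed.

(** Links the product weights on functions from ['I_n] to draws listed one by
    one, by splitting off the value at [ord0]. *)
Lemma sum_ffun_iid_mean n (F : seq A -> R) :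
  \sum_(c : {ffun 'I_n -> A}) (\prod_(i < n) w (c i)) * F (codom c) =
  iid_mean n F.
Proof.
elim: n F => [|n IH] F /=.
  have c0 : (fun c : {ffun 'I_0 -> A} => true) =1
      pred1 [ffun i : 'I_0 => False_rect A (notF (ltn_ord i))].
    by move=> c; apply/esym/eqP/ffunP => -[].
  rewrite (eq_bigl _ _ c0) big_pred1_eq big_ord0 mul1r; congr F.
  by apply: size0nil; rewrite size_codom card_ord.
pose ext (u : A * {ffun 'I_n -> A}) : {ffun 'I_n.+1 -> A} :=
  [ffun i => if unlift ord0 i is Some j then u.2 j else u.1].
pose cut (c : {ffun 'I_n.+1 -> A}) := (c ord0, [ffun j => c (lift ord0 j)]).
have extK : cancel ext cut.
  case=> a c; rewrite /cut /ext ffunE unlift_none; congr (_, _).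
  by apply/ffunP => j; rewrite !ffunE liftK.
have cutK : cancel cut ext.
  move=> c; apply/ffunP => i; rewrite ffunE.
  by case: unliftP => [j|] ->; rewrite //= ffunE.
rewrite (reindex ext); last by exists cut => ? _.
rewrite (eq_bigr (fun u : A * {ffun 'I_n -> A} =>
    w u.1 * ((\prod_(i < n) w (u.2 i)) * F (u.1 :: codom u.2)))).
  rewrite -(pair_bigA _ (fun a (c : {ffun 'I_n -> A}) =>
    w a * ((\prod_(i < n) w (c i)) * F (a :: codom c)))) /=.
  by apply: eq_bigr => a _; rewrite -big_distrr (IH (fun l => F (a :: l))).
case=> a c _; rewrite big_ord_recl mulrA /= ffunE unlift_none.
congr (_ * _ * F _).
  by apply: eq_bigr => i _; rewrite ffunE liftK.
rewrite /codom /image_mem enum_ordSl /= ffunE unlift_none; congr cons.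
by rewrite -map_comp; apply: eq_map => j /=; rewrite ffunE liftK.
Qed.

Lemma pair_sum_sorted n (K : A -> A -> R) (c : 'I_n -> A) (s : seq 'I_n) :
  pairwise (fun i j : 'I_n => i < j)%N s ->
  pair_sum K (map c s) = \sum_(i <- s) \sum_(j <- s | (i < j)%N) K (c i) (c j).
Proof.
elim: s => [|i s IH] /=; first by rewrite big_nil.
case/andP => /allP lis /IH ->; rewrite !big_cons ltnn big_map; congr (_ + _).
  rewrite big_seq [RHS]big_seq_cond; apply: eq_bigl => j.
  by case js: (j \in s) => //=; rewrite lis.
rewrite big_seq [RHS]big_seq; apply: eq_bigr => j js.
by rewrite big_cons ltnNge ltnW // lis.
Qed.

End IidMean.

(** * The shuffled deck and its inversions *)

(** When card [i] made the choice [a] and a larger card [j] the choice [b], this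
    tells whether [j] ends above [i]. *)
Definition inverts (m : nat) (a b : 'I_m * bool) : bool :=
  (b.1 < a.1)%N || (b.1 == a.1) && ~~ a.2.

Section Deck.
Variables (n m : nat) (c : choices n m).

(** The order of the cards in the shuffled deck.  It is defined from the choices
    alone, so that [pairwise above] determines the deck up to the set of its
    cards. *)
Definition above (i j : 'I_n) : bool :=
  if (i < j)%N then ~~ inverts (c i) (c j)
  else (j < i)%N && inverts (c j) (c i).

Lemma above_irr : irreflexive above.
Proof. by move=> i; rewrite /above ltnn. Qed.

Lemma above_shelf (i j : 'I_n) : ((c i).1 < (c j).1)%N -> above i j.
Proof.
move=> lt_ij; rewrite /above /inverts lt_ij.
have -> : ((c j).1 < (c i).1)%N = false by apply/negbTE; rewrite -leqNgt ltnW.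
have -> : ((c j).1 == (c i).1) = false by rewrite -val_eqE gtn_eqF.
case: ltngtP => // eq_ij.
by move: lt_ij; rewrite (val_inj eq_ij) ltnn.
Qed.

(** Dealing in decreasing order, each new card is smaller than all those already
    on its shelf, so its end of the pile is what [above] asks for. *)
Lemma foldr_place (s : seq 'I_n) (k : 'I_m) :
  pairwise (fun i j : 'I_n => i < j)%N s ->
  let h := foldr (fun i h => place c h i) [ffun=> [::]] s in
  pairwise above (h k) /\ h k =i [pred i in s | (c i).1 == k].
Proof.
elim: s => [|i s IH] /=; first by rewrite ffunE; split=> // j.
case/andP => /allP lt_is /IH {IH}[]; set h := foldr _ _ _ => hk memh.
rewrite ffunE [k == _]eq_sym; have [eik|nik] := eqVneq; last first.
  split=> // j; rewrite memh !inE; case: (eqVneq j i) => //= ->.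
  by rewrite (negbTE nik) andbF.
split.
  case top: (c i).2; rewrite /= ?pairwise_rcons hk andbT; apply/allP => j.
    rewrite memh inE => /andP[js /eqP ejk].
    by rewrite /above lt_is // /inverts ejk eik ltnn eqxx top.
  rewrite memh inE => /andP[js /eqP ejk].
  by rewrite /above ltnNge ltnW lt_is //= /inverts ejk eik ltnn eqxx top.
move=> j; rewrite !inE.
have -> : (j \in (if (c i).2 then i :: h k else rcons (h k) i)) =
    (j == i) || (j \in h k).
  by case: (c i).2; rewrite ?mem_rcons inE.
by rewrite memh inE; case: (eqVneq j i) => //= ->; rewrite eik eqxx.
Qed.

Lemma pairwise_enum_ord k : pairwise (fun i j : 'I_k => i < j)%N (enum 'I_k).
Proof.
rewrite -(pairwise_map val ltn) val_enum_ord -(sorted_pairwise ltn_trans).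
exact: iota_ltn_sorted.
Qed.

Lemma deal_pile (k : 'I_m) :
  pairwise above (deal c k) /\ deal c k =i [pred i | (c i).1 == k].
Proof.
rewrite /deal foldl_rev; have [pw mem] := foldr_place k (pairwise_enum_ord n).
by split=> // i; rewrite mem !inE mem_enum.
Qed.

Lemma mem_shuffled_deck i : i \in shuffled_deck c.
Proof.
apply/flatten_mapP; exists (c i).1; first by rewrite mem_enum.
by have [_ ->] := deal_pile (c i).1; rewrite inE.
Qed.

Lemma pairwise_shuffled_deck : pairwise above (shuffled_deck c).
Proof.
rewrite /shuffled_deck; elim: (enum 'I_m) (pairwise_enum_ord m) => //= k s IH.
case/andP => /allP lt_ks /IH pw; rewrite pairwise_cat pw.
have [-> memk] := deal_pile k; rewrite !andbT; apply/allrelP => i j.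
rewrite memk inE => /eqP eik /flatten_mapP[l /lt_ks lt_kl].
have [_ ->] := deal_pile l; rewrite inE => /eqP ejl.
by apply: above_shelf; rewrite eik ejl.
Qed.

Lemma shuffled_deck_uniq : uniq (shuffled_deck c).
Proof. exact: pairwise_uniq above_irr pairwise_shuffled_deck. Qed.

Lemma size_shuffled_deck : size (shuffled_deck c) = n.
Proof.
rewrite -[RHS]card_ord -(card_uniqP shuffled_deck_uniq).
by apply: eq_card => i; rewrite mem_shuffled_deck.
Qed.

Lemma shuffled_deck_perm : exists s : 'S_n, shuffled_deck c = codom s.
Proof.
have sz := introT eqP size_shuffled_deck.
pose f := tnth (Tuple sz).
have f_inj : injective f by apply/tuple_uniqP; exact: shuffled_deck_uniq.
exists (perm f_inj).
rewrite -[LHS]/(tval (Tuple sz)) -[in LHS](map_tnth_enum (Tuple sz)).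
by apply: eq_map => i; rewrite permE.
Qed.

Lemma shuffled_deck_above (s : 'S_n) (x y : 'I_n) :
  shuffled_deck c = codom s -> (x < y)%N -> above (s x) (s y).
Proof.
move=> deck_s lt_xy.
have := pairwise_shuffled_deck; rewrite deck_s /codom /image_mem pairwise_map.
move/(pairwiseP x) => /(_ x y); rewrite !inE -!cardE !card_ord !nth_ord_enum.
exact.
Qed.

(** [s] turns inverted positions into inverted cards, the upper position holding
    the larger card: hence the swap in the bijection. *)
Lemma inversions_shuffled_deck (s : 'S_n) : shuffled_deck c = codom s ->
  inversions s =
  #|[set ij : 'I_n * 'I_n | (ij.1 < ij.2)%N && inverts (c ij.1) (c ij.2)]|.
Proof.
move=> deck_s; rewrite /inversions.
pose f (ij : 'I_n * 'I_n) := (s ij.2, s ij.1).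
have f_inj : injective f by move=> [? ?] [? ?] [/perm_inj -> /perm_inj ->].
rewrite -(card_imset _ f_inj); apply: eq_card => -[i j].
have -> : (i, j) = f (s^-1%g j, s^-1%g i) by rewrite /f /= !permKV.
rewrite mem_imset // !inE /= !permKV.
case lt_ij: (i < j)%N; rewrite ?andbF // andbT /=.
have := @shuffled_deck_above s (s^-1 j)%g (s^-1 i)%g deck_s.
have := @shuffled_deck_above s (s^-1 i)%g (s^-1 j)%g deck_s.
rewrite !permKV /above lt_ij [(j < i)%N]ltnNge (ltnW lt_ij) /=.
case: ltngtP => [_ /(_ isT)/negbTE -> //|_ _ /(_ isT) -> //|].
by move/val_inj/perm_inj => eji; rewrite eji ltnn in lt_ij.
Qed.

End Deck.

(** * The shelf law as a law of independent draws *)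

Lemma pair_sum_codom (R : realFieldType) (A : finType) n (K : A -> A -> R)
    (c : {ffun 'I_n -> A}) :
  pair_sum K (codom c) =
  \sum_(ij : 'I_n * 'I_n | (ij.1 < ij.2)%N) K (c ij.1) (c ij.2).
Proof.
rewrite /codom /image_mem pair_sum_sorted ?pairwise_enum_ord // big_enum /=.
under eq_bigr do rewrite big_enum_cond /=.
by rewrite (pair_big_dep xpredT (fun i j : 'I_n => (i < j)%N)
  (fun i j => K (c i) (c j))).
Qed.

Section Law.
Variables (R : realType) (n m : nat) (p : R).

Definition card_weight (a : 'I_m * bool) : R :=
  m%:R^-1 * (if a.2 then p else 1 - p).

Lemma inversions_pair_sum (c : choices n m) (s : 'S_n) :
  shuffled_deck c = codom s ->
  (inversions s)%:R = pair_sum (fun a b => (inverts a b)%:R : R) (codom c).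
Proof.
move=> /inversions_shuffled_deck ->; rewrite pair_sum_codom -sum1_card natr_sum.
rewrite big_mkcond [RHS]big_mkcond; apply: eq_bigr => ij _; rewrite inE.
by case: ltnP => //= _; case: inverts.
Qed.

(** Every choice function yields exactly one permutation, so summing over the
    permutations and then over the choices leading to them is summing over the
    choices. *)
Lemma sum_shelf_law (F : R -> R) :
  \sum_(s : 'S_n) F (inversions s)%:R * shelf_law m p s =
  iid_mean card_weight n
    (fun l => F (pair_sum (fun a b => (inverts a b)%:R) l)).
Proof.
rewrite -sum_ffun_iid_mean /shelf_law.
under eq_bigr do rewrite big_mkcond big_distrr /=.
rewrite exchange_big /=; apply: eq_bigr => c _.
have [s deck_s] := shuffled_deck_perm c.
(* Only the permutation [s] read off the deck of [c] contributes. *)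
rewrite (bigD1 s) //= deck_s eqxx big1 ?addr0; last first.
  move=> t ts; case: eqP => [eq_st|_]; rewrite ?mulr0 //.
  case/eqP: ts; apply/permP => i.
  have /eq_in_map/(_ i) : map s (enum 'I_n) = map t (enum 'I_n) by [].
  by rewrite mem_enum => ->.
by rewrite (inversions_pair_sum deck_s) mulrC.
Qed.

End Law.

Section Integral.
Variables (R : realType) (d : measure_display) (T : measurableType d).
Variables (P : probability T R).
Variables (F : finType) (pi : T -> F) (f : F -> R).
Hypothesis law_pi : has_law P pi f.

Lemma expectation_law (G : F -> R) :
  ('E_P[fun t => G (pi t)] = (\sum_x G x * f x)%:E)%E.
Proof.
rewrite unlock.
have GE t : (G (pi t))%:E =
    (\sum_x (G x)%:E * (\1_(pi @^-1` [set x])%classic t)%:E)%E.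
  rewrite (bigD1 (pi t)) //= big1 ?adde0 => [|x xt].
    by rewrite indicE mem_set //= mule1.
  by rewrite indicE memNset ?mule0 //= => /esym/eqP; exact/negP.
under eq_integral do rewrite GE.
rewrite integral_sum //; last first.
  move=> x; apply: integrableZl => //; apply: integrable_indic.
  by case: (law_pi x).
rewrite -sumEFin; apply: eq_bigr => x _; have [mx Px] := law_pi x.
rewrite integralZl ?integral_indic ?setIT //.
  by rewrite EFinM; congr (_ * _)%E; exact: Px.
exact: integrable_indic.
Qed.
End Integral.

(** * Moments of the inversion kernel *)

Lemma sum_ord_val (R : realFieldType) k :
  \sum_(s < k) (val s)%:R = k%:R * (k%:R - 1) / 2 :> R.
Proof.
elim: k => [|k IH]; first by rewrite big_ord0; field.
by rewrite big_ord_recr /= IH -[k.+1%:R]natr1; field.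
Qed.

Lemma sum_ord_sqr (R : realFieldType) k :
  \sum_(s < k) (val s)%:R ^+ 2 = k%:R * (k%:R - 1) * (2 * k%:R - 1) / 6 :> R.
Proof.
elim: k => [|k IH]; first by rewrite big_ord0; field.
by rewrite big_ord_recr /= IH -[k.+1%:R]natr1; field.
Qed.

Section Kernel.
Variables (R : realType) (m : nat) (p : R).
Hypothesis m_gt0 : (0 < m)%N.
Let w := @card_weight R m p.
Let M : R := m%:R.
Let M0 : M != 0. Proof. by rewrite pnatr_eq0 -lt0n. Qed.
Let q := 1 - p.

Lemma mean_shelf (f : 'I_m -> bool -> R) :
  mean w (fun a => f a.1 a.2) =
  M^-1 * \sum_(s < m) (p * f s true + q * f s false).
Proof.
rewrite /mean big_distrr /=.
rewrite -(pair_bigA _ (fun s b => w (s, b) * f s b)) /=; apply: eq_bigr => s _.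
by rewrite big_bool /w /card_weight /M /q /=; ring.
Qed.

Lemma sum_card_weight : \sum_a w a = 1.
Proof.
transitivity (mean w (fun=> 1)); first by apply: eq_bigr => a _; rewrite mulr1.
rewrite (mean_shelf (fun _ _ => 1)) sumr_const card_ord -[_ *+ m]mulr_natl -/M.
by rewrite /q; field.
Qed.

Definition inv_prob : R := 1 / 2 - (2 * p - 1) / (2 * M).

Definition centred_inverts (a b : 'I_m * bool) : R :=
  (inverts a b)%:R - inv_prob.

Lemma sum_gtn_ord (s : 'I_m) : \sum_(t < m) (t < s)%N%:R = (val s)%:R :> R.
Proof.
transitivity (\sum_(t < m | (t < s)%N) (1 : R)).
  by rewrite [RHS]big_mkcond; apply: eq_bigr => t _; case: ltnP.
by rewrite -(big_ord_widen m (fun=> 1)) ?sumr_const ?card_ord // ltnW.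
Qed.

Lemma sum_eq_ord (s : 'I_m) (x : R) : \sum_(t < m) (t == s)%:R * x = x.
Proof.
rewrite (bigD1 s) //= eqxx mul1r big1 ?addr0 // => t /negbTE ->.
by rewrite mul0r.
Qed.

Lemma sum_ltn_ord (s : 'I_m) :
  \sum_(t < m) (s < t)%N%:R = M - 1 - (val s)%:R :> R.
Proof.
suff -> : M = \sum_(t < m) (s < t)%N%:R + 1 + (val s)%:R by ring.
rewrite -sum_gtn_ord -[X in _ + X + _](sum_eq_ord s) -!big_split /=.
rewrite /M -[m in LHS]card_ord -sumr_const; apply: eq_bigr => t _.
by rewrite -val_eqE; case: ltngtP => _ /=; ring.
Qed.

Lemma invertsE (a b : 'I_m * bool) :
  (inverts a b)%:R = (b.1 < a.1)%N%:R + (b.1 == a.1)%:R * (~~ a.2)%:R :> R.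
Proof.
by rewrite /inverts -val_eqE; case: ltngtP; case: a.2 => /= _; ring.
Qed.

Lemma mean_centred_inverts_row a :
  mean w (centred_inverts a) = M^-1 * ((val a.1)%:R + (~~ a.2)%:R) - inv_prob.
Proof.
rewrite /centred_inverts meanD (mean_cst sum_card_weight); congr (_ - _).
rewrite (mean_shelf (fun s _ => (inverts a (s, true))%:R)); congr (_ * _).
rewrite -(sum_eq_ord a.1 (~~ a.2)%:R) -sum_gtn_ord -big_split /=.
by apply: eq_bigr => s _; rewrite invertsE /q /=; ring.
Qed.

Lemma mean_centred_inverts_col b :
  mean w (centred_inverts^~ b) = M^-1 * (M - 1 - (val b.1)%:R + q) - inv_prob.
Proof.
rewrite /centred_inverts meanD (mean_cst sum_card_weight); congr (_ - _).
rewrite (mean_shelf (fun s t => (inverts (s, t) b)%:R)); congr (_ * _).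
rewrite -{2}(sum_eq_ord b.1 q) -sum_ltn_ord -big_split /=.
by apply: eq_bigr => s _; rewrite !invertsE [b.1 == s]eq_sym /q /=; ring.
Qed.

Lemma mean_centred_inverts : mean w (fun a => mean w (centred_inverts a)) = 0.
Proof.
under eq_mean do rewrite mean_centred_inverts_row.
rewrite (mean_shelf (fun s t => M^-1 * ((val s)%:R + (~~ t)%:R) - inv_prob)).
have -> : \sum_(s < m) (p * (M^-1 * ((val s)%:R + (~~ true)%:R) - inv_prob) +
    q * (M^-1 * ((val s)%:R + (~~ false)%:R) - inv_prob)) =
  M^-1 * \sum_(s < m) (val s)%:R + \sum_(s < m) (M^-1 * q - inv_prob).
  rewrite big_distrr -big_split; apply: eq_bigr => s _ /=; rewrite /q; ring.
rewrite sum_ord_val sumr_const card_ord -[_ *+ m]mulr_natl -/M /inv_prob /q.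
by field.
Qed.

(** The sum of the two projections is affine in the top/bottom bit and free of
    the shelf, its mean over the bit being zero, whereas the column projection
    depends on the shelf alone. *)
Lemma centred_inverts_orth :
  mean w (fun a => (mean w (centred_inverts a) + mean w (centred_inverts^~ a)) *
                   mean w (centred_inverts^~ a)) = 0.
Proof.
under eq_mean do rewrite mean_centred_inverts_row mean_centred_inverts_col.
rewrite (mean_shelf (fun s t => (M^-1 * ((val s)%:R + (~~ t)%:R) - inv_prob +
   (M^-1 * (M - 1 - (val s)%:R + q) - inv_prob)) *
   (M^-1 * (M - 1 - (val s)%:R + q) - inv_prob))).
(* The mean over the bit vanishes already for each fixed shelf. *)
rewrite big1 ?mulr0 // => s _ /=; rewrite /inv_prob /q; field.
exact: M0.
Qed.

Lemma mean_centred_inverts_row_sqr :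
  mean w (fun a => mean w (centred_inverts a) ^+ 2) =
  1 / 12 + 1 / (6 * M ^+ 2) - (2 * p - 1) ^+ 2 / (4 * M ^+ 2).
Proof.
under eq_mean do rewrite mean_centred_inverts_row.
rewrite (mean_shelf
  (fun s t => (M^-1 * ((val s)%:R + (~~ t)%:R) - inv_prob) ^+ 2)).
have -> : \sum_(s < m)
   (p * (M^-1 * ((val s)%:R + (~~ true)%:R) - inv_prob) ^+ 2 +
    q * (M^-1 * ((val s)%:R + (~~ false)%:R) - inv_prob) ^+ 2) =
  M^-1 ^+ 2 * \sum_(s < m) (val s)%:R ^+ 2 +
  2 * M^-1 * (M^-1 * q - inv_prob) * \sum_(s < m) (val s)%:R +
  \sum_(s < m) (p * inv_prob ^+ 2 + q * (M^-1 - inv_prob) ^+ 2).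
  rewrite !big_distrr -!big_split; apply: eq_bigr => s _ /=; rewrite /q; ring.
rewrite sum_ord_sqr sum_ord_val sumr_const card_ord -[_ *+ m]mulr_natl -/M.
by rewrite /inv_prob /q; field.
Qed.

(** As [inverts] is 0 or 1, this is the Bernoulli variance
    [inv_prob * (1 - inv_prob)]. *)
Lemma mean_centred_inverts_sqr :
  mean w (fun a => mean w (fun b => centred_inverts a b ^+ 2)) =
  1 / 4 - (2 * p - 1) ^+ 2 / (4 * M ^+ 2).
Proof.
have sqrE a b : centred_inverts a b ^+ 2 =
    (1 - 2 * inv_prob) * centred_inverts a b + inv_prob * (1 - inv_prob).
  by rewrite /centred_inverts; case: inverts => /=; ring.
under eq_mean => a.
  under eq_mean do rewrite sqrE.
  rewrite meanD meanZ (mean_cst sum_card_weight); over.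
rewrite meanD meanZ (mean_cst sum_card_weight) mean_centred_inverts /inv_prob.
by field.
Qed.

End Kernel.

(** * Mean and variance *)

Theorem corollary2p15 (R : realType) (n m : nat) (p : R)
    (hn : (1 <= n)%N) (hm : (1 <= m)%N) (hp0 : 0 < p) (hp1 : p < 1)
    (d : measure_display) (T : measurableType d) (P : probability T R)
    (pi : T -> 'S_n) (hpi : has_law P pi (shelf_law m p)) :
  let I_n : T -> R := fun t => (inversions (pi t))%:R in
  let delta : R := 2 * p - 1 in
  let N : R := n%:R in
  let M : R := m%:R in
  ('E_P[I_n] = ('C(n, 2)%:R * (1 / 2 - delta / (2 * M)))%:E)%E /\
  (variance P I_n =
     (N * (N - 1) * (2 * N + 5) / 72
      + N * (N - 1) * (N - 2) / (18 * M ^+ 2)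
      - delta ^+ 2 * (N * (N - 1) * (2 * N - 1)) / (24 * M ^+ 2))%:E)%E.
Proof.
move=> I_n delta N M.
have M0 : M != 0 by rewrite pnatr_eq0 -lt0n.
have w1 := sum_card_weight p hm.
have binE : 'C(n, 2)%:R = N * (N - 1) / 2 :> R.
  by rewrite -bin2_sum big_mkord natr_sum sum_ord_val.
have dev l : pair_sum (centred_inverts p) l =
    pair_sum (fun a b : 'I_m * bool => (inverts a b)%:R) l -
    (size l)%:R * ((size l)%:R - 1) / 2 * inv_prob m p.
  exact: pair_sum_shift.
have law_E F : ('E_P[fun t => F (I_n t)] =
    (iid_mean (card_weight p) n
      (fun l =>
        F (pair_sum (fun a b : 'I_m * bool => (inverts a b)%:R) l)))%:E)%E.
  rewrite -sum_shelf_law.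
  by rewrite (expectation_law hpi (fun s => F (inversions s)%:R)).
have EI : ('E_P[I_n] = (N * (N - 1) / 2 * inv_prob m p)%:E)%E.
  rewrite (law_E id); congr _%:E.
  have := iid_mean_pair_sum w1 n (centred_inverts p).
  rewrite mean_centred_inverts // mulr0 => dev0.
  rewrite -[LHS](subrK (N * (N - 1) / 2 * inv_prob m p)) -[RHS]add0r.
  congr (_ + _).
  rewrite -dev0 -[X in _ + X](iid_mean_cst w1 n) -iid_meanD.
  by apply: eq_iid_mean => l sl; rewrite dev sl.
split; first by rewrite EI binE.
rewrite /variance covariance.unlock EI /=.
rewrite (law_E (fun x =>
  (x - N * (N - 1) / 2 * inv_prob m p) *
  (x - N * (N - 1) / 2 * inv_prob m p))).
congr _%:E.
transitivity (iid_mean (card_weight p) n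
  (fun l => pair_sum (@centred_inverts R m p) l ^+ 2)).
  by apply: eq_iid_mean => l sl; rewrite dev sl expr2.
rewrite (iid_mean_pair_sum_sqr w1 (mean_centred_inverts p hm)
  (centred_inverts_orth p hm)).
rewrite mean_centred_inverts_sqr // mean_centred_inverts_row_sqr //.
by rewrite -/N -/M /delta; field.
Qed.
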